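(* Let $T$ be a Taimanov semigroup and let $S$ be a homomorphic image of $T$ (that is, a semigroup for which there is a surjective semigroup homomorphism $T\to S$) which is not isomorphic to $T$. Then $S$ is a topological semigroup with respect to any topology on $S$.
   Context: A semigroup $T$ is called a Taimanov semigroup if it contains two distinct elements $0_T,\infty_T$ such that for any $x,y\in T$: $x\cdot y=\infty_T$ if $x\ne y$ and $x,y\in T\setminus\{0_T,\infty_T\}$; and $x\cdot y=0_T$ if $x=y$ or $\{x,y\}\cap\{0_T,\infty_T\}\neq\emptyset$. No finiteness or infiniteness of $T$ is assumed. A topological semigroup is a semigroup $S$ endowed with a topology such that the semigroup operation $S\times S\to S$ is (jointly) continuous; no separation axiom is included in this definition. *)

(* Defs.v *)
From HB Require Import structures.
From mathcomp Require Import all_boot.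
From mathcomp Require Import classical_sets functions topology.

Set Implicit Arguments.
Unset Strict Implicit.
Unset Printing Implicit Defensive.

Local Open Scope classical_set_scope.
Local Open Scope group_scope.

Definition taimanov (T : semigroupType) : Prop :=
  exists zero infty : T,
    zero <> infty /\
    forall x y : T,
      (x <> y -> (~` [set zero; infty]) x -> (~` [set zero; infty]) y ->
         x * y = infty) /\
      (x = y \/ [set x; y] `&` [set zero; infty] !=set0 -> x * y = zero).

Definition homomorphic_image (T S : semigroupType) : Prop :=
  exists f : {multiplicative T -> S}, set_surj [set: T] [set: S] f.

Definition isomorphic (T S : semigroupType) : Prop :=
  exists f : {multiplicative T -> S}, bijective f.

(* A semigroup together with a topology, not assumed to be compatible with the
   multiplication. *)
#[short(type="preTopologicalSemigroupType")]
HB.structure Definition PreTopologicalSemigroup :=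
  {S of Topological S & Semigroup S}.

(* [continuous] refers to the product topology on [S * S]. *)
Definition topological_semigroup (S : preTopologicalSemigroupType) : Prop :=
  continuous (fun p : S * S => p.1 * p.2).

(* Main.v *)
(* Let [f] be a surjective homomorphism identifying two points [a <> b] of [T],
   and suppose [T] has two distinct elements outside [{0, oo}] (otherwise every
   product in [T] is already [0]).  Then [f oo = f 0]: either
   [{a, b} = {0, oo}], or multiplying [a] and [b] by a suitable element gives
   [oo] and [0].  So the multiplication of [S] is constant. *)
Require Import Defs.
From HB Require Import structures.
From mathcomp Require Import all_boot.
From mathcomp Require Import boolp classical_sets functions topology.

Local Open Scope classical_set_scope.
Local Open Scope group_scope.

Lemma taimanov_mul_cases (T : semigroupType) (zero infty : T)
    (hmul : forall x y : T,
      (x <> y -> (~` [set zero; infty]) x -> (~` [set zero; infty]) y ->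
         x * y = infty) /\
      (x = y \/ [set x; y] `&` [set zero; infty] !=set0 -> x * y = zero))
    (x y : T) :
  x * y = zero \/
  [/\ x <> y, (~` [set zero; infty]) x, (~` [set zero; infty]) y
    & x * y = infty].
Proof.
have [hinf hzero] := hmul x y.
have [xy|xy] := pselect (x = y); first by left; apply: hzero; left.
have [sx|nx] := pselect ([set zero; infty] x).
  by left; apply: hzero; right; exists x; split=> //; left.
have [sy|ny] := pselect ([set zero; infty] y).
  by left; apply: hzero; right; exists y; split=> //; right.
by right; split=> //; apply: hinf.
Qed.

Lemma taimanov_hom_mul_const (T S : semigroupType) (f : {multiplicative T -> S})
    (hT : taimanov T) (hf : ~ injective f) :
  exists c : S, forall x y : T, f (x * y) = c.
Proof.
have [zero [infty [zi hmul]]] := hT.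
have mulP := taimanov_mul_cases T zero infty hmul.
exists (f zero) => x y.
have [->//|[xy nx ny ->]] := mulP x y.
(* Contraposition: if [f] separates [infty] from [zero], it is injective. *)
apply: contrapT => fi; apply: hf => a b fab; apply: contrapT => ab.
(* Products only take the values [zero] and [infty], which [f] separates. *)
have mulE c : a * c = b * c.
  have fc : f (a * c) = f (b * c) by rewrite !gmulfM fab.
  by move: fc; have [->|[_ _ _ ->]] := mulP a c;
     have [->|[_ _ _ ->]] := mulP b c => // /esym.
have special d e : d <> e -> (forall c, d * c = e * c) ->
    [set zero; infty] d.
  move=> de dec; apply: contrapT => nd.
  (* [x] and [y] are distinct, so one of them differs from [d]. *)
  have [c [nc dc]] : exists c, (~` [set zero; infty]) c /\ d <> c.
    have [dx|dx] := pselect (d = x); last by exists x.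
    by exists y; split=> //; rewrite dx.
  (* [e * c = d * c = infty] forces [e] out of [{zero, infty}]. *)
  have ne : (~` [set zero; infty]) e.
    have [ec|[]//] := mulP e c.
    by case: zi; rewrite -ec -dec (hmul d c).1.
  (* Testing against [e] itself: [infty = d * e = e * e = zero]. *)
  apply: zi; rewrite -(hmul d e).1 // dec.
  by symmetry; apply: (hmul e e).2; left.
have sa := special a b ab mulE.
have sb : [set zero; infty] b.
  by apply: (special b a) => [/esym//|c]; rewrite mulE.
(* [a] and [b] are [zero] and [infty] in some order, so [fab] contradicts [fi]. *)
by move: sa sb fab ab => [->|->] [->|->] // /esym.
Qed.

Theorem corollary1 (T : semigroupType) (S : preTopologicalSemigroupType)
    (hT : taimanov T) (hS : homomorphic_image T S) (hTS : ~ isomorphic T S) :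
  topological_semigroup S.
Proof.
have [f f_surj] := hS.
have f_ninj : ~ injective f.
  move=> f_inj; apply: hTS; exists f; rewrite -setTT_bijective.
  by split=> // u v _ _ /f_inj.
have [c fc] := taimanov_hom_mul_const _ _ f hT f_ninj.
rewrite /topological_semigroup.
(* Factors in [S] lift along [f], so the product on [S] is constant, hence continuous for any
   topology. *)
have -> : (fun p : S * S => p.1 * p.2) = cst c.
  apply/funext => -[u v] /=.
  have [x _ <-] := f_surj u I; have [y _ <-] := f_surj v I.
  by rewrite -gmulfM.
exact: cst_continuous.
Qed.
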